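(* For any integers $k, r$ with $1 \leq r \leq k-2$, the injective chromatic number of the Kneser graph satisfies \[\chi_i\big(K(2k+r,k)\big) \leq \left(\frac{9}{4}k + \frac{9(r+3)}{8}\right)^r.\]
   Context: The Kneser graph $K(n,k)$ ($n \ge 2k$) has as vertices the $k$-element subsets of an $n$-element set, two vertices adjacent iff disjoint. An injective $m$-coloring of a graph is an assignment of at most $m$ colors to the vertices such that any two distinct vertices having a common neighbor receive different colors; the injective chromatic number $\chi_i(G)$ is the least $m$ for which $G$ admits an injective $m$-coloring. *)

(* Defs.v *)
From mathcomp Require Import all_boot all_order all_algebra.

Set Implicit Arguments.
Unset Strict Implicit.
Unset Printing Implicit Defensive.

(* A finite simple graph is a symmetric irreflexive relation e : rel T on a   *)
(* finType T.                                                                 *)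
Section InjectiveColoring.
Variables (T : finType) (e : rel T).

Definition common_neighbor (x y : T) : bool := [exists z, e x z && e y z].

(* "At most m colors": the color map into 'I_m need not be onto.              *)
Definition injective_coloring (m : nat) (c : {ffun T -> 'I_m}) : bool :=
  [forall x, forall y, (x != y) && common_neighbor x y ==> (c x != c y)].

Definition injective_colorable (m : nat) : bool :=
  [exists c : {ffun T -> 'I_m}, injective_coloring c].

Lemma injective_colorable_card : injective_colorable #|T|.
Proof.
apply/existsP; exists [ffun x => enum_rank x].
apply/forallP => x; apply/forallP => y; apply/implyP => /andP[xy _].
by rewrite !ffunE (inj_eq enum_rank_inj).
Qed.

Lemma ex_injective_colorable : exists m, injective_colorable m.
Proof. by exists #|T|; apply: injective_colorable_card. Qed.

Definition injective_chromatic_number : nat := ex_minn ex_injective_colorable.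

End InjectiveColoring.

Definition kneser_vertex (n k : nat) : finType :=
  {A : {set 'I_n} | #|A| == k}.

Definition kneser (n k : nat) : rel (kneser_vertex n k) :=
  fun A B => [disjoint val A & val B].

Lemma kneser_sym (n k : nat) : symmetric (@kneser n k).
Proof. by move=> A B; rewrite /kneser disjoint_sym. Qed.

(* For k = 0 the single vertex set0 would carry a loop.                       *)
Lemma kneser_irrefl (n k : nat) : 0 < k -> irreflexive (@kneser n k).
Proof.
move=> k_gt0 A; rewrite /kneser -setI_eq0 setIid -cards_eq0 (eqP (valP A)).
by rewrite eqn0Ngt k_gt0.
Qed.

(* Main.v *)
Require Import Defs.
From Stdlib Require Import ZArith NArith Reals Lra Classical.
From mathcomp Require Import all_boot all_order all_algebra all_field zify.

Set Implicit Arguments.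
Unset Strict Implicit.
Unset Printing Implicit Defensive.

(* Put n = 2k + r and embed the ground set into a field F with q >= n elements.
   Color a k-set A by the coefficients of X^(k-1), ..., X^(k-r) in the monic
   polynomial P_A with root set A.  Two sets A, B with a common neighbor satisfy
   |A :&: B| >= k - r; if they have the same color, P_A - P_B has degree less than
   k - r and vanishes on A :&: B, so A = B.  Hence q^r colors suffice.

   It remains to find a prime power q with n <= q <= 9(n + 3)/8.  Small n are
   covered by an explicit chain of primes.  For large n let x = 9n - 1 and consider
   the quotient of the products of the factorials floor(x/d)! over two lists of d
   with the same sum of reciprocals.  The exponent of a prime p in it is the sum of
   F(floor(x/p^j)) over j >= 1, where F(i) is the difference of the two sums of
   floor(i/d).  The lists are such that, for i <> 8, F(i) <= 0 when i < 856,
   F(i) <= 1 when i < 8648, and F(i) <= 12 always.  If no prime power q had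
   floor(x/q) = 8, that is x/9 < q <= x/8, the quotient would divide
   L(x/856) * L(x/8648)^11 with L(m) = lcm(1, ..., m) <= 4^m, which is smaller than
   what Stirling's formula gives. *)

(** * Factorials, least common multiples and p-adic valuations *)

Lemma sum_nat_leq e m : e < m -> \sum_(1 <= k < m) (k <= e) = e.
Proof.
move=> lt_em; rewrite (@big_cat_nat _ _ _ e.+1) //=.
rewrite [X in _ + X]big_nat_cond [X in _ + X]big1 ?addn0; last first.
  by move=> i /andP[/andP[le_ei _] _]; rewrite leqNgt le_ei.
rewrite (eq_big_nat _ _ (F2 := fun=> 1)) => [|i /andP[_]]; last first.
  by rewrite ltnS => ->.
by rewrite sum_nat_const_nat muln1 subn1.
Qed.

(** Legendre's formula with a summation range that may exceed [n], so that the formulas for several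
    factorials can be added term by term. *)
Lemma logn_fact_wide p n m :
  prime p -> n < m -> logn p n`! = \sum_(1 <= k < m) n %/ p ^ k.
Proof.
move=> p_pr lt_nm; rewrite logn_fact // [RHS](@big_cat_nat _ _ _ n.+1) //=.
rewrite [X in _ = _ + X]big_nat_cond [X in _ = _ + X]big1 ?addn0 //.
move=> i /andP[/andP[lt_ni _] _]; rewrite divn_small //.
exact: ltn_trans lt_ni (ltn_expl _ (prime_gt1 p_pr)).
Qed.

Lemma dvdn_from_log m n : 0 < m -> 0 < n ->
  (forall p, prime p -> logn p m <= logn p n) -> m %| n.
Proof.
move=> m_gt0 n_gt0 le_log; apply/dvdn_partP => // p.
rewrite mem_primes p_part => /andP[p_pr _].
by rewrite pfactor_dvdn // le_log.
Qed.

Lemma logn_prod_seq (I : Type) p (s : seq I) (f : I -> nat) :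
  (forall i, 0 < f i) ->
  logn p (\prod_(i <- s) f i) = \sum_(i <- s) logn p (f i).
Proof.
move=> f_gt0; elim: s => [|i s IHs]; first by rewrite !big_nil logn1.
by rewrite !big_cons lognM ?IHs ?prodn_gt0.
Qed.

(** * Least common multiples of initial segments and the bound 4^n *)

Definition lcm_upto n := \big[lcmn/1]_(1 <= i < n.+1) i.

Lemma lcm_uptoS n : lcm_upto n.+1 = lcmn (lcm_upto n) n.+1.
Proof. by rewrite /lcm_upto big_nat_recr. Qed.

Lemma lcm_upto_gt0 n : 0 < lcm_upto n.
Proof.
elim: n => [|n IHn]; first by rewrite /lcm_upto big_geq.
by rewrite lcm_uptoS lcmn_gt0 IHn.
Qed.

(** The exponent of [p] in an lcm is a maximum, so a power of [p] divides the lcm only if it divides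
    one of 1, ..., n. At k = n = 0 the equality would fail. *)
Lemma pfactor_dvd_lcm_upto p k n :
  prime p -> 0 < k -> (p ^ k %| lcm_upto n) = (p ^ k <= n).
Proof.
move=> p_pr k_gt0; have pk_gt1 : 1 < p ^ k.
  by apply: leq_trans (prime_gt1 p_pr) _; rewrite -{1}(expn1 p) leq_exp2l ?prime_gt1.
elim: n => [|n IHn].
  by rewrite /lcm_upto big_geq // dvdn1 leqn0; move: pk_gt1; case: (p ^ k) => [|[]].
rewrite lcm_uptoS pfactor_dvdn ?lcmn_gt0 ?lcm_upto_gt0 // logn_lcm ?lcm_upto_gt0 //.
rewrite leq_max -!pfactor_dvdn ?lcm_upto_gt0 // IHn.
apply/orP/idP => [[/leqW //|]|]; first exact: dvdn_leq.
by rewrite leq_eqVlt ltnS => /orP[/eqP->|->]; [right|left].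
Qed.

(** As a sum of indicators over [k], this exponent can be compared termwise with Legendre's
    formula. *)
Lemma logn_lcm_upto p n m : prime p -> n < m ->
  logn p (lcm_upto n) = \sum_(1 <= k < m) (p ^ k <= n).
Proof.
move=> p_pr lt_nm; set e := logn p _.
have e_lt : e < m.
  have [->|e_gt0] := posnP e; first exact: leq_ltn_trans lt_nm.
  apply: leq_ltn_trans lt_nm; apply: ltnW.
  apply: leq_trans (ltn_expl e (prime_gt1 p_pr)) _.
  by rewrite -pfactor_dvd_lcm_upto // pfactor_dvdn ?lcm_upto_gt0.
rewrite -{1}(sum_nat_leq e_lt); apply: eq_big_nat => k /andP[k_gt0 _].
by rewrite -pfactor_dvd_lcm_upto // pfactor_dvdn ?lcm_upto_gt0.
Qed.

(** The binomial coefficients sum to 2^n. For odd [n] the two middle ones are equal, which saves the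
    extra factor 2. *)
Lemma half_bin_le n : 'C(n, n./2) <= 4 ^ n./2.
Proof.
have sumC m : \sum_(i < m.+1) 'C(m, i) = 2 ^ m.
  rewrite -[2]/(1 + 1) expnDn; apply: eq_bigr => i _.
  by rewrite !exp1n !muln1.
have [odd_n|even_n] := boolP (odd n).
  have def_n : n = n./2.*2.+1 by rewrite -[LHS]odd_double_half odd_n.
  set m := n./2 in def_n *; rewrite def_n.
  have lt1 : m < m.*2.+2 by lia.
  have lt2 : m.+1 < m.*2.+2 by lia.
  rewrite -(leq_pmul2l (m := 2)) //.
  have -> : 2 * 4 ^ m = 2 ^ m.*2.+1 by rewrite expnS -[4]/(2 ^ 2) -expnM (mul2n m).
  rewrite -sumC (bigD1 (Ordinal lt1)) //= (bigD1 (Ordinal lt2)) /=; last first.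
    by rewrite -val_eqE /= eqn_leq ltnn.
  have -> : 'C(m.*2.+1, m.+1) = 'C(m.*2.+1, m).
    by rewrite -bin_sub; [congr 'C(_, _); lia | lia].
  by rewrite addnA mul2n -addnn leq_addr.
have def_n : n = n./2.*2 by rewrite -[LHS]odd_double_half (negPf even_n).
set m := n./2 in def_n *; rewrite def_n.
have -> : 4 ^ m = 2 ^ m.*2 by rewrite -[4]/(2 ^ 2) -expnM mul2n.
have lt1 : m < m.*2.+1 by lia.
by rewrite -sumC (bigD1 (Ordinal lt1)) //= leq_addr.
Qed.

(** Strong induction: if n = a + b with a the lower half, then [lcm_upto n] divides
    ['C(n, a) * lcm_upto b], whose factors are at most 4^a and 4^b. *)
Lemma lcm_upto_le n : lcm_upto n <= 4 ^ n.
Proof.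
have [m] := ubnP n; elim: m n => // m IHm n; rewrite ltnS => le_nm.
have [n_le1|n_gt1] := leqP n 1.
  case: n n_le1 {le_nm} => [|[|//]] _; first by rewrite /lcm_upto big_geq.
  by rewrite /lcm_upto big_nat1.
set a := n./2; set b := n - a.
have ab : a + b = n by rewrite /a /b; lia.
have le_ab : a <= b by rewrite /a /b; lia.
have lt_bn : b < n by rewrite /a /b; lia.
have dv : lcm_upto n * (a`! * b`!) %| n`! * lcm_upto b.
  apply: dvdn_from_log => [||p p_pr]; rewrite ?muln_gt0 ?lcm_upto_gt0 ?fact_gt0 //.
  rewrite !lognM ?muln_gt0 ?lcm_upto_gt0 ?fact_gt0 //.
  rewrite (@logn_lcm_upto p n n.+1) // (@logn_lcm_upto p b n.+1) //; last by lia.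
  rewrite !(@logn_fact_wide p _ n.+1) //; try by lia.
  rewrite -!big_split /=; apply: leq_sum => k _.
  have : 0 < p ^ k by rewrite expn_gt0 prime_gt0.
  move: (p ^ k) => q q_gt0; rewrite -ab.

  have : a %/ q + b %/ q <= (a + b) %/ q by rewrite divnD ?leq_addr.
  (* If q <= b, both indicators are 1 and superadditivity of the floor suffices; otherwise the
     quotients of [a] and [b] by [q] vanish. *)
  have [le_qb|lt_bq] := leqP q b; first by case: (q <= a + b); lia.
  rewrite (divn_small lt_bq) (divn_small (leq_ltn_trans le_ab lt_bq)).
  by case: (leqP q (a + b)) => // le_q _; rewrite !addn0 divn_gt0.
have := dvdn_leq _ dv; rewrite muln_gt0 fact_gt0 lcm_upto_gt0 => /(_ isT).
rewrite -(@bin_fact n a) -/b; last by rewrite /a; lia.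
rewrite mulnAC leq_pmul2r ?muln_gt0 ?fact_gt0 // => leL.
apply: leq_trans leL _; rewrite -[X in 4 ^ X]ab expnD.
by rewrite leq_mul ?half_bin_le ?IHm ?(leq_trans lt_bn).
Qed.

(** Since floors of iterated quotients commute, the exponents of [p] on both sides are sums over [k]
    of the two sides of the hypothesis; likewise v <= floor(x/p^k) iff p^k <= floor(x/v). *)
Lemma chebyshev_dvd (num den hs : seq nat) (x : nat) :
  (forall p k, prime p -> 0 < k ->
     \sum_(d <- num) (x %/ p ^ k) %/ d <=
     \sum_(d <- den) (x %/ p ^ k) %/ d + \sum_(v <- hs) (v <= x %/ p ^ k)) ->
  all (ltn 0) hs ->
  \prod_(d <- num) (x %/ d)`! %|
    \prod_(d <- den) (x %/ d)`! * \prod_(v <- hs) lcm_upto (x %/ v).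
Proof.
move=> le_sum hs_gt0.
have fgt0 (d : nat) : 0 < (x %/ d)`! by exact: fact_gt0.
have lgt0 (d : nat) : 0 < lcm_upto (x %/ d) by exact: lcm_upto_gt0.
apply: dvdn_from_log => [||p p_pr]; rewrite ?muln_gt0 ?prodn_gt0 //.
rewrite lognM ?prodn_gt0 // !logn_prod_seq //.
have lt_x (d : nat) : x %/ d < x.+1 by rewrite ltnS leq_div.
have -> : \sum_(d <- num) logn p (x %/ d)`! =
    \sum_(1 <= k < x.+1) \sum_(d <- num) (x %/ p ^ k) %/ d.
  rewrite exchange_big; apply: eq_bigr => d _.
  by rewrite (logn_fact_wide p_pr (lt_x d)); apply: eq_bigr => k _; rewrite divnAC.
have -> : \sum_(d <- den) logn p (x %/ d)`! =
    \sum_(1 <= k < x.+1) \sum_(d <- den) (x %/ p ^ k) %/ d.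
  rewrite exchange_big; apply: eq_bigr => d _.
  by rewrite (logn_fact_wide p_pr (lt_x d)); apply: eq_bigr => k _; rewrite divnAC.
have -> : \sum_(v <- hs) logn p (lcm_upto (x %/ v)) =
    \sum_(1 <= k < x.+1) \sum_(v <- hs) (v <= x %/ p ^ k).
  rewrite exchange_big big_seq [RHS]big_seq; apply: eq_bigr => v v_hs.
  have v_gt0 : 0 < v by exact: (allP hs_gt0).
  rewrite (logn_lcm_upto p_pr (lt_x v)); apply: eq_bigr => k _.
  have pk_gt0 : 0 < p ^ k by rewrite expn_gt0 prime_gt0.
  by rewrite (leq_divRL _ _ v_gt0) (leq_divRL _ _ pk_gt0) mulnC.
rewrite -big_split /= big_nat [X in _ <= X]big_nat.
by apply: leq_sum => k /andP[k_gt0 _]; apply: le_sum.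
Qed.

(** * Explicit primes and Chebyshev weights *)

Lemma N_to_nat_div a b : N.to_nat (a / b) = N.to_nat a %/ N.to_nat b.
Proof.
have [->|b_neq0] := eqVneq b 0%num; first by case: a.
have b_gt0 : 0 < N.to_nat b by move/eqP: b_neq0; lia.
have lt_ab := N.mod_lt a b (elimN eqP b_neq0).
rewrite {2}(N.div_mod a b (elimN eqP b_neq0)) N2Nat.inj_add N2Nat.inj_mul.
rewrite -[(_ + _)%coq_nat]/(_ + _) -[(_ * _)%coq_nat]/(_ * _).
by rewrite mulnC divnMDl // divn_small ?addn0 //; lia.
Qed.

Lemma N_to_nat_mod a b : N.to_nat (a mod b) = N.to_nat a %% N.to_nat b.
Proof.
have := congr1 N.to_nat (N.div_mod' a b).
rewrite N2Nat.inj_add N2Nat.inj_mul N_to_nat_div {1}(divn_eq (N.to_nat a) (N.to_nat b)).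
by rewrite mulnC => /addnI.
Qed.

(** The tested index is binary to keep the computations fast; only the recursion length is unary. *)
Fixpoint all_from (t : N -> bool) (a : N) (l : nat) : bool :=
  if l is l'.+1 then t a && all_from t (N.succ a) l' else true.

Lemma all_fromP t a l i :
  all_from t a l -> N.to_nat a <= i < N.to_nat a + l -> t (N.of_nat i).
Proof.
elim: l a => [|l IHl] a /=; first by lia.
move=> /andP[ta /IHl{}IHl] le_ai.
have [->|ne_ai] := eqVneq i (N.to_nat a); first by rewrite N2Nat.id.
by apply: IHl; move/eqP: ne_ai; lia.
Qed.

Definition trial_division (n : N) : bool :=
  (1 <? n)%num &&
  all_from (fun d => ~~ (n mod d =? 0)%num) 2 (N.to_nat (N.sqrt n - 1)).

Lemma trial_divisionP n : trial_division n -> prime (N.to_nat n).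
Proof.
move=> /andP[/N.ltb_lt n_gt1 /all_fromP no_div].
have n_gt0 : 0 < N.to_nat n by lia.
have n_gt1' : 1 < N.to_nat n by lia.
apply: ltn_pdiv2_prime => //; rewrite ltnNge; apply/negP => le_p2.
set p := pdiv _ in le_p2; have p_gt1 : 1 < p by exact/prime_gt1/pdiv_prime.
have p_le : (N.of_nat p <= N.sqrt n)%num by apply/N.sqrt_le_square; lia.
have /no_div : N.to_nat 2 <= p < N.to_nat 2 + N.to_nat (N.sqrt n - 1) by lia.
move/N.eqb_spec; apply; apply: N2Nat.inj.
by rewrite N_to_nat_mod Nat2N.id; apply/eqP/pdiv_dvd.
Qed.

(** The prime [q] serves every n with m < n <= q; the size condition is the one for the worst case n
    = m + 1. *)
Fixpoint prime_chain (m : N) (s : seq N) : bool :=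
  if s is q :: s' then
    [&& trial_division q, (8 * q <=? 9 * N.succ m + 27)%num & prime_chain q s']
  else true.

Lemma prime_chainP m s n : prime_chain m s ->
  N.to_nat m < n <= N.to_nat (last m s) ->
  exists p, [/\ prime p, n <= p & 8 * p <= 9 * n + 27].
Proof.
elim: s m => [|q s IHs] m; first by rewrite [last _ _]/=; lia.
rewrite [last _ _]/= => /and3P[/trial_divisionP q_pr /N.leb_le le_q /IHs{}IHs] n_in.
have [le_nq|lt_qn] := leqP n (N.to_nat q); last by apply: IHs; lia.
by exists (N.to_nat q); split=> //; lia.
Qed.

Definition prime_list : seq N :=
  [:: 7; 11; 13; 19; 23; 29; 37; 43; 47; 53; 61; 73; 83; 97; 113; 131; 151; 173;
   199; 227; 257; 293; 331; 373; 421; 467; 523; 587; 661; 743; 839; 947; 1069;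
   1201; 1327; 1493; 1669; 1879; 2113; 2381; 2683; 3019; 3391; 3803; 4273; 4801;
   5399; 6073; 6833; 7691; 8647; 9721; 10939; 12301; 13841; 15569; 17519; 19709;
   22171; 24943; 28057; 31567; 35509; 39937; 44927; 50543; 56857; 63949; 71947;
   80933; 91033; 102409; 115211;
   129607; 145807; 164023; 184523; 207589; 233509]%num.

Lemma prime_between_small n : 7 <= n -> 9 * n <= 2 * 10 ^ 6 ->
  exists p, [/\ prime p, n <= p & 8 * p <= 9 * n + 27].
Proof.
(* The chain covers every n from 7 to its last prime, which exceeds 2 * 10^6 / 9. *)
move=> n_ge7 n_le; apply: (@prime_chainP 6 prime_list).
  by vm_compute.
have -> : last 6%num prime_list = 233509%num by [].
by lia.
Qed.

(* These weights were found by linear programming and local search, aiming at a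
   large value of sum_ln_div cheb_den - sum_ln_div cheb_num. *)
Definition cheb_num : seq N :=
  [:: 8; 18; 27; 45; 48; 63; 112; 160; 168; 168; 210; 360; 378; 448; 576]%num.

Definition cheb_den : seq N :=
  [:: 9; 16; 24; 40; 54; 56; 90; 126; 144; 189; 224; 336; 420]%num.

(** * Verification of the floor-sum inequalities *)

Definition sum_div (s : seq N) (i : N) : N :=
  foldr (fun d a => (i / d + a)%num) 0%num s.

Lemma sum_divE s i :
  N.to_nat (sum_div s i) = \sum_(d <- map N.to_nat s) N.to_nat i %/ d.
Proof.
elim: s => [|d s IHs] /=; first by rewrite big_nil.
by rewrite big_cons N2Nat.inj_add IHs N_to_nat_div.
Qed.

Definition cheb_test (i : N) : bool :=
  (i =? 8)%num ||
  (sum_div cheb_num i <=? sum_div cheb_den i + (if (856 <=? i)%num then 1 else 0))%num.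

Lemma cheb_test_small : all_from cheb_test 0 (N.to_nat 8648).
Proof. by vm_compute. Qed.

Lemma sum_div_ub (m i : nat) (s : seq nat) :
  0 < m -> all (fun d => d %| m) s ->
  m * (\sum_(d <- s) i %/ d) <= i * (\sum_(d <- s) m %/ d).
Proof.
move=> m_gt0; elim: s => [|d s IHs]; first by rewrite !big_nil !muln0.
rewrite !big_cons !mulnDr => /andP[dv_dm /IHs{}IHs]; apply: leq_add => //.
rewrite -{1}(divnK dv_dm) -mulnA mulnC leq_mul2r.
by rewrite [d * _]mulnC leq_divM orbT.
Qed.

(** Multiplying i/d < floor(i/d) + 1 by [m] gives a strict inequality of integers, hence a gain of 1
    for each entry. This gain makes the gap below 13, the length of [cheb_den]. *)
Lemma sum_div_lb (m i : nat) (s : seq nat) :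
  0 < m -> all (fun d => d %| m) s ->
  i * (\sum_(d <- s) m %/ d) + size s <= m * (\sum_(d <- s) i %/ d + size s).
Proof.
move=> m_gt0; elim: s => [|d s IHs]; first by rewrite !big_nil !muln0.
rewrite !big_cons /= => /andP[dv_dm /IHs{}IHs].
have d_gt0 : 0 < d by exact: dvdn_gt0 dv_dm.
have : i * (m %/ d) < m * (i %/ d).+1.
  rewrite -{2}(divnK dv_dm) -mulnA mulnC ltn_pmul2l ?divn_gt0 ?(dvdn_leq _ dv_dm) //.
  by rewrite mulnC ltn_ceil.
by move: IHs; lia.
Qed.

(* Every [d] divides 60480, and both lists have the same sum of reciprocals. *)
Lemma cheb_gap_le i :
  \sum_(d <- map N.to_nat cheb_num) i %/ d <=
  \sum_(d <- map N.to_nat cheb_den) i %/ d + 12.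
Proof.
(* An abstract [m] prevents the unary numeral from being expanded. *)
have [m def_m] : exists m, m = N.to_nat 60480 by exists (N.to_nat 60480).
have m_gt0 : 0 < m by rewrite def_m; lia.
have dvd_all s : all (fun d => 60480 mod d =? 0)%num s ->
    all (fun d => d %| m) (map N.to_nat s).
  rewrite all_map; apply: sub_all => d /N.eqb_spec /(congr1 N.to_nat).
  by rewrite N_to_nat_mod -def_m => md0; apply/eqP.
have sumE s :
    \sum_(d <- map N.to_nat s) m %/ d = N.to_nat (sum_div s 60480).
  by rewrite sum_divE def_m.
have num_dvd : all (fun d => d %| m) (map N.to_nat cheb_num) by apply: dvd_all.
have den_dvd : all (fun d => d %| m) (map N.to_nat cheb_den) by apply: dvd_all.
have := sum_div_ub i m_gt0 num_dvd; have := sum_div_lb i m_gt0 den_dvd.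
rewrite !sumE -[sum_div cheb_num _]/(sum_div cheb_den 60480%num).
rewrite [size _]/=; move: (i * _) => t le_den le_num.
rewrite -ltnS -addnS -(ltn_pmul2l m_gt0); apply: leq_ltn_trans le_num _.
by apply: leq_trans le_den; rewrite -addn1 leq_add2l.
Qed.

(** Below 8648 the finite check applies; from there on all twelve indicators are 1 and match the
    general gap of 12. *)
Lemma cheb_le i : i != 8 ->
  \sum_(d <- map N.to_nat cheb_num) i %/ d <=
  \sum_(d <- map N.to_nat cheb_den) i %/ d +
  \sum_(v <- map N.to_nat (856 :: nseq 11 8648)%num) (v <= i).
Proof.
move=> i_neq8; have gap := cheb_gap_le i.
rewrite [X in _ + X](_ : _ =
  (N.to_nat 856 <= i) + (N.to_nat 8648 <= i) * 11); last first.
  by rewrite big_map big_cons big_nseq iter_addn_0.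
have [lt_i|le_i] := ltnP i (N.to_nat 8648); last first.
  have -> : N.to_nat 856 <= i by lia.
  exact: gap.
rewrite mul0n addn0; have := all_fromP cheb_test_small (i := i) lt_i.
case/orP => [/N.eqb_spec|/N.leb_le]; first by move/eqP: i_neq8; lia.
have sumE s : \sum_(d <- map N.to_nat s) i %/ d =
    N.to_nat (sum_div s (N.of_nat i)) by rewrite sum_divE Nat2N.id.
rewrite !sumE.
move: (sum_div cheb_num _) (sum_div cheb_den _) => a b.
by case: N.leb_spec => le_i; lia.
Qed.

(** * Stirling's formula and the size of the quotient *)

Section RealEstimates.

Local Open Scope R_scope.

Lemma ln_div a b : 0 < a -> 0 < b -> ln (a / b) = ln a - ln b.
Proof.
move=> a_gt0 b_gt0; rewrite /Rdiv ln_mult ?ln_Rinv //.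
exact: Rinv_0_lt_compat.
Qed.

Lemma ln_le a b : 0 < a -> a <= b -> ln a <= ln b.
Proof.
move=> a_gt0 [lt_ab|->]; last exact: Rle_refl.
exact/Rlt_le/ln_increasing.
Qed.

(** The tangent bound ln t <= t - 1 at t = b/a; exchanging [a] and [b] gives the opposite
    estimate. *)
Lemma ln_diff_le a b : 0 < a -> 0 < b -> a * (ln b - ln a) <= b - a.
Proof.
move=> a_gt0 b_gt0; have ba_gt0 : 0 < b / a by exact: Rdiv_lt_0_compat.
have -> : ln b - ln a = ln (b / a) by rewrite ln_div.
have := exp_ineq1_le (ln (b / a)); rewrite exp_ln // => le_ln.
have -> : b - a = a * (b / a - 1) by field; lra.
by apply: Rmult_le_compat_l; lra.
Qed.

(** The induction step amounts to 1/(m+1) <= ln(m+1) - ln m <= 1/m. *)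
Lemma ln_fact_bounds n : (0 < n)%N ->
  INR n * ln (INR n) - INR n + 1 <= ln (INR n`!)
    <= (INR n + 1) * ln (INR n) - INR n + 1.
Proof.
elim: n => // -[|n] IHn _; first by rewrite /= ln_1; lra.
have [lo up] := IHn isT; have m_gt0 : 0 < INR n.+1 by apply: lt_0_INR; lia.
have f_gt0 : 0 < INR n.+1`! by apply: lt_0_INR; have := fact_gt0 n.+1; lia.
rewrite factS mult_INR (S_INR n.+1) ln_mult //; last lra.
have lo' := ln_diff_le (a := INR n.+1) (b := INR n.+1 + 1) m_gt0.
have up' := ln_diff_le (a := INR n.+1 + 1) (b := INR n.+1).
set m := INR n.+1 in m_gt0 lo up lo' up' *.
have {}lo' := lo' ltac:(lra); have {}up' := up' ltac:(lra) m_gt0.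
by split; nra.
Qed.

Lemma INR_divn_bounds (x d : nat) : (0 < d)%N ->
  INR (x %/ d) <= INR x / INR d < INR (x %/ d) + 1.
Proof.
move=> d_gt0; have d_pos : 0 < INR d by apply: lt_0_INR; lia.
have def_x : INR x = INR (x %/ d) * INR d + INR (x %% d).
  by rewrite -mult_INR -plus_INR -[(_ + _)%coq_nat]/(_ + _)%N -divn_eq.
have r_lt : INR (x %% d) < INR d by apply: lt_INR; have := ltn_pmod x d_gt0; lia.
have r_ge : 0 <= INR (x %% d) by exact: pos_INR.
have -> : INR x / INR d = INR (x %/ d) + INR (x %% d) / INR d.
  by rewrite def_x; field; lra.
have q_mul : INR (x %% d) / INR d * INR d = INR (x %% d) by field; lra.
by split; nra.
Qed.

(** The main term is y ln y - y at the real quotient y = x/d. By tangent bounds, rounding [y] down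
    lowers it by at most ln y, and the bounds on ln n! leave a further ln n + 1. *)
Lemma ln_fact_divn (x d : nat) : (0 < d <= x)%N ->
  Rabs (ln (INR (x %/ d)`!) - INR x * (ln (INR x) - 1 - ln (INR d)) / INR d)
    <= ln (INR x) + 1.
Proof.
move=> /andP[d_gt0 le_dx]; set n := (x %/ d)%N.
have n_gt0 : (0 < n)%N by rewrite divn_gt0.
have [lo up] := ln_fact_bounds n_gt0; have [le_ny lt_yn] := INR_divn_bounds x d_gt0.
have d_ge1 : 1 <= INR d by apply: (le_INR 1); lia.
have x_gt0 : 0 < INR x by apply: lt_0_INR; lia.
have n_ge1 : 1 <= INR n by apply: (le_INR 1); lia.
rewrite -/n in le_ny lt_yn; set y := INR x / INR d in le_ny lt_yn.
have ln_y : ln y = ln (INR x) - ln (INR d) by rewrite ln_div //; lra.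
have ln_d_ge0 : 0 <= ln (INR d) by rewrite -ln_1; apply: ln_le; lra.
have ln_n_ge0 : 0 <= ln (INR n) by rewrite -ln_1; apply: ln_le; lra.
have ln_ny : ln (INR n) <= ln y by apply: ln_le; lra.
have -> : INR x * (ln (INR x) - 1 - ln (INR d)) / INR d = y * ln y - y.
  by rewrite ln_y /y; field; lra.
have h1 := ln_diff_le (a := INR n) (b := y) ltac:(lra) ltac:(lra).
have h2 := ln_diff_le (a := y) (b := INR n) ltac:(lra) ltac:(lra).
by apply: Rabs_le; split; nra.
Qed.

Definition sum_inv (s : seq N) : R :=
  foldr (fun d a => / IZR (Z.of_N d) + a) 0 s.

Definition sum_ln_div (s : seq N) : R :=
  foldr (fun d a => ln (IZR (Z.of_N d)) / IZR (Z.of_N d) + a) 0 s.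

Lemma INR_N_to_nat d : INR (N.to_nat d) = IZR (Z.of_N d).
Proof. by rewrite INR_IZR_INZ; congr IZR; lia. Qed.

(** For two lists with equal [sum_inv] the x ln x terms cancel, leaving [x] times the difference of
    their [sum_ln_div]. *)
Lemma ln_prod_fact_divn (x : nat) (s : seq N) :
  all (fun d => 0 < N.to_nat d <= x)%N s ->
  Rabs (ln (INR (\prod_(d <- map N.to_nat s) (x %/ d)`!))
        - (INR x * (ln (INR x) - 1) * sum_inv s - INR x * sum_ln_div s))
    <= INR (size s) * (ln (INR x) + 1).
Proof.
elim: s => [_|d s IHs /andP[d_in /IHs{}IHs]].
  by rewrite big_nil [INR 1]/= ln_1 /= !Rmult_0_r Rmult_0_l !Rminus_0_r Rabs_R0; lra.
rewrite [size _]/= S_INR [sum_inv _]/= [sum_ln_div _]/= [map _ _]/= big_cons.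
rewrite mult_INR ln_mult; try by
  apply: lt_0_INR; apply/ltP; rewrite ?fact_gt0 ?prodn_gt0 // => i; rewrite fact_gt0.
have := ln_fact_divn d_in; rewrite INR_N_to_nat.
set p := ln (INR _`!) in IHs *; set q := ln (INR (\prod_(_ <- _) _)%N) in IHs *.
set e := IZR (Z.of_N d) => hd; set l := ln (INR x) in IHs hd *.
have -> : p + q - (INR x * (l - 1) * (/ e + sum_inv s) -
    INR x * (ln e / e + sum_ln_div s)) =
  (p - INR x * (l - 1 - ln e) / e) +
  (q - (INR x * (l - 1) * sum_inv s - INR x * sum_ln_div s)).
  by rewrite /Rdiv; ring.
by apply: Rle_trans (Rabs_triang _ _) _; lra.
Qed.

Lemma ln_prod_lcm_upto (x : nat) (s : seq N) :
  all (fun d => 0 < N.to_nat d)%N s ->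
  ln (INR (\prod_(d <- map N.to_nat s) lcm_upto (x %/ d)))
    <= 2 * ln 2 * INR x * sum_inv s.
Proof.
elim: s => [_|d s IHs /andP[d_gt0 /IHs{}IHs]].
  by rewrite big_nil /= ln_1; lra.
have L_gt0 := lcm_upto_gt0 (x %/ N.to_nat d).
rewrite /= big_cons mult_INR ln_mult; try by
  apply: lt_0_INR; apply/ltP; rewrite ?prodn_gt0 // => i; rewrite lcm_upto_gt0.
suff : ln (INR (lcm_upto (x %/ N.to_nat d))) <=
    2 * ln 2 * (INR x / IZR (Z.of_N d)) by rewrite /Rdiv; lra.
have ln2_gt0 : 0 < ln 2 by have := ln_lt_2; lra.
have [le_div _] := INR_divn_bounds x d_gt0; rewrite INR_N_to_nat in le_div.
apply: Rle_trans (_ : INR (x %/ N.to_nat d) * (2 * ln 2) <= _); last by nra.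
have -> : 2 * ln 2 = ln 4 by rewrite -[2 * _]/(INR 2 * _) -ln_pow; [congr ln|]; lra.
rewrite -ln_pow; last lra.
apply: ln_le; first by apply: lt_0_INR; lia.
have -> : 4 = INR 4 by rewrite /=; lra.
rewrite -pow_INR; apply: le_INR; apply/leP.
have -> : Nat.pow 4 (x %/ N.to_nat d) = (4 ^ (x %/ N.to_nat d))%N.
  by elim: (x %/ _)%N => // k IHk; rewrite expnS -IHk.
exact: lcm_upto_le.
Qed.

Lemma ln_smooth7 a b c d :
  ln (2 ^ a * 3 ^ b * 5 ^ c * 7 ^ d) =
    INR a * ln 2 + INR b * ln 3 + INR c * ln 5 + INR d * ln 7.
Proof.
have pow_gt0 n k : 0 < n -> 0 < n ^ k by exact: pow_lt.
by rewrite !ln_mult ?ln_pow //; repeat apply: Rmult_lt_0_compat; try apply: pow_gt0; lra.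
Qed.

(* Smooth ratios close to 1 pin down the direction of (ln 2, ln 3, ln 5, ln 7)
   through the first-order bounds 1 - 1/t <= ln t <= t - 1 alone. *)
Lemma cheb_constant :
  sum_inv cheb_num = sum_inv cheb_den /\
  sum_ln_div cheb_num + 2 * ln 2 * sum_inv (856 :: nseq 11 8648)%num
    + 3 / 10000 <= sum_ln_div cheb_den /\
  ln 2000000 <= 146 / 10.
Proof.
split; first by rewrite /=; lra.
have smooth a b c d n : n = 2 ^ a * 3 ^ b * 5 ^ c * 7 ^ d ->
  ln n = INR a * ln 2 + INR b * ln 3 + INR c * ln 5 + INR d * ln 7.
  by move->; exact: ln_smooth7.
have ratio a b : 0 < a -> 0 < b -> (b - a) / b <= ln b - ln a <= (b - a) / a.
  move=> a_gt0 b_gt0.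
  have h1 := ln_diff_le a_gt0 b_gt0; have h2 := ln_diff_le b_gt0 a_gt0.
  have e1 : (b - a) / a * a = b - a by field; lra.
  have e2 : (b - a) / b * b = b - a by field; lra.
  by split; nra.
(* The exponent vectors of these four ratios form a matrix of determinant 1 or -1, so bounds on
   their logarithms bound each of ln 2, ln 3, ln 5 and ln 7. *)
have r1 := ratio 4374 4375 ltac:(lra) ltac:(lra).
have r2 := ratio 2400 2401 ltac:(lra) ltac:(lra).
have r3 := ratio 224 225 ltac:(lra) ltac:(lra).
have r4 := ratio 125 126 ltac:(lra) ltac:(lra).
rewrite (smooth 1%N 7%N 0%N 0%N 4374) in r1; last lra.
rewrite (smooth 0%N 0%N 4%N 1%N 4375) in r1; last lra.
rewrite (smooth 5%N 1%N 2%N 0%N 2400) in r2; last lra.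
rewrite (smooth 0%N 0%N 0%N 4%N 2401) in r2; last lra.
rewrite (smooth 5%N 0%N 0%N 1%N 224) in r3; last lra.
rewrite (smooth 0%N 2%N 2%N 0%N 225) in r3; last lra.
rewrite (smooth 0%N 0%N 3%N 0%N 125) in r4; last lra.
rewrite (smooth 1%N 2%N 0%N 1%N 126) in r4; last lra.
split; last by rewrite (smooth 7%N 0%N 6%N 0%N 2000000); simpl in *; lra.
rewrite /cheb_num /cheb_den /=.
rewrite (smooth 3%N 0%N 0%N 0%N 8); last lra.
rewrite (smooth 0%N 2%N 0%N 0%N 9); last lra.
rewrite (smooth 4%N 0%N 0%N 0%N 16); last lra.
rewrite (smooth 1%N 2%N 0%N 0%N 18); last lra.
rewrite (smooth 3%N 1%N 0%N 0%N 24); last lra.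
rewrite (smooth 0%N 3%N 0%N 0%N 27); last lra.
rewrite (smooth 3%N 0%N 1%N 0%N 40); last lra.
rewrite (smooth 0%N 2%N 1%N 0%N 45); last lra.
rewrite (smooth 4%N 1%N 0%N 0%N 48); last lra.
rewrite (smooth 1%N 3%N 0%N 0%N 54); last lra.
rewrite (smooth 3%N 0%N 0%N 1%N 56); last lra.
rewrite (smooth 0%N 2%N 0%N 1%N 63); last lra.
rewrite (smooth 1%N 2%N 1%N 0%N 90); last lra.
rewrite (smooth 4%N 0%N 0%N 1%N 112); last lra.
rewrite (smooth 1%N 2%N 0%N 1%N 126); last lra.
rewrite (smooth 4%N 2%N 0%N 0%N 144); last lra.
rewrite (smooth 5%N 0%N 1%N 0%N 160); last lra.
rewrite (smooth 3%N 1%N 0%N 1%N 168); last lra.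
rewrite (smooth 0%N 3%N 0%N 1%N 189); last lra.
rewrite (smooth 1%N 1%N 1%N 1%N 210); last lra.
rewrite (smooth 5%N 0%N 0%N 1%N 224); last lra.
rewrite (smooth 4%N 1%N 0%N 1%N 336); last lra.
rewrite (smooth 3%N 2%N 1%N 0%N 360); last lra.
rewrite (smooth 1%N 3%N 0%N 1%N 378); last lra.
rewrite (smooth 2%N 1%N 1%N 1%N 420); last lra.
rewrite (smooth 6%N 0%N 0%N 1%N 448); last lra.
rewrite (smooth 6%N 2%N 0%N 0%N 576); last lra.
simpl in *; lra.
Qed.

(** Otherwise the divisibility, after taking logarithms, gives 3x/10000 <= 28 (ln x + 1), with one
    error term for each of the 15 + 13 factorials. This is false from 2 * 10^6 on. *)
Lemma prime_power_quotient8 (x : nat) : (2 * 10 ^ 6 <= x)%N ->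
  ~ (forall p k, prime p -> (0 < k)%N -> (x %/ p ^ k != 8)%N).
Proof.
move=> x_ge no_q.
have hs_gt0 : all (fun d => 0 < N.to_nat d)%N (856 :: nseq 11 8648)%num by [].
have dv := @chebyshev_dvd (map N.to_nat cheb_num) (map N.to_nat cheb_den)
  (map N.to_nat (856 :: nseq 11 8648)%num) x
  (fun p k p_pr k_gt0 => cheb_le (no_q p k p_pr k_gt0)).
have /dv/dvdn_leq {dv} : all (ltn 0%N) (map N.to_nat (856 :: nseq 11 8648)%num).
  by rewrite all_map.
have f_gt0 s : (0 < \prod_(d <- s) (x %/ d)`!)%N.
  by apply: prodn_gt0 => d; rewrite fact_gt0.
have l_gt0 s : (0 < \prod_(d <- s) lcm_upto (x %/ d))%N.
  by apply: prodn_gt0 => d; rewrite lcm_upto_gt0.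
rewrite muln_gt0 f_gt0 l_gt0 => /(_ isT) /leP /le_INR.
have INR_gt0 m : (0 < m)%N -> 0 < INR m by move=> m_gt0; apply: lt_0_INR; lia.
rewrite mult_INR => /(ln_le (INR_gt0 _ (f_gt0 _))).
rewrite ln_mult; [|exact/INR_gt0/f_gt0|exact/INR_gt0/l_gt0].
have all_in s : all (fun d => (0 <? d) && (d <=? 2000000))%num s ->
    all (fun d => 0 < N.to_nat d <= x)%N s.
  by apply: sub_all => d /andP[/N.ltb_lt ? /N.leb_le ?]; lia.
have := ln_prod_fact_divn (all_in cheb_num isT).
have := ln_prod_fact_divn (all_in cheb_den isT).
have := ln_prod_lcm_upto x hs_gt0.
have [-> [cst ln2e6]] := cheb_constant.
rewrite [INR (size cheb_num)]/= [INR (size cheb_den)]/=.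
have x_gt0 : 0 < INR x by apply: INR_gt0; lia.
have x_large : 2000000 <= INR x.
  by rewrite INR_IZR_INZ; apply: IZR_le; lia.
(* The tangent at 2 * 10^6 makes the upper bound on ln x linear in x. *)
have := ln_diff_le (a := 2000000) (b := INR x) ltac:(lra) x_gt0.
move: (ln (INR (\prod_(d <- map _ cheb_num) _)%N)) => lnum.
move: (ln (INR (\prod_(d <- map _ cheb_den) _)%N)) => lden.
move: (ln (INR (\prod_(d <- _) lcm_upto _)%N)) => llcm.
move: (sum_inv cheb_den) (sum_inv _) cst => u w.
move: (sum_ln_div cheb_num) (sum_ln_div cheb_den) => sn sd cst.
have abs_le a b : Rabs a <= b -> - b <= a <= b.
  by move=> le_ab; have := Rle_abs a; have := Rle_abs (- a); rewrite Rabs_Ropp; lra.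
move=> lnx h1 /abs_le h2 /abs_le h3 h4.
have h5 : INR x * (sn + 2 * ln 2 * w + 3 / 10000) <= INR x * sd.
  by apply: Rmult_le_compat_l; lra.
by lra.
Qed.

End RealEstimates.

Lemma prime_power_between n : 7 <= n ->
  exists p k, [/\ prime p, 0 < k, n <= p ^ k & 8 * p ^ k <= 9 * n + 27].
Proof.
move=> n_ge7; have [n_small|n_large] := leqP (9 * n) (2 * 10 ^ 6).
  have [p [p_pr le_np p_le]] := prime_between_small n_ge7 n_small.
  by exists p, 1; rewrite expn1.
have x_ge : 2 * 10 ^ 6 <= (9 * n).-1 by lia.
(* For x = 9n - 1, a quotient 8 means 8q <= 9n - 1 < 9q, and the second inequality says n <= q. *)
apply: NNPP => no_q; apply: (prime_power_quotient8 x_ge) => p k p_pr k_gt0.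
apply/eqP => quo; apply: no_q; exists p, k; split=> //.
  by rewrite leqNgt; apply/negP => lt_qn; move: quo; nia.
by nia.
Qed.

(** * Coloring Kneser graphs *)

Import Order.TTheory GRing.Theory Num.Theory.

Local Open Scope ring_scope.

(** The union of [A] and [B] avoids [C], so it has at most n - k <= k + r elements;
    inclusion-exclusion does the rest. *)
Lemma card_setI_common_disjoint (n k r : nat) (A B C : {set 'I_n}) :
  #|A| = k -> #|B| = k -> #|C| = k -> (n <= 2 * k + r)%N ->
  [disjoint A & C] -> [disjoint B & C] -> (k - r <= #|A :&: B|)%N.
Proof.
move=> cA cB cC le_n dAC dBC.
have dABC : [disjoint A :|: B & C].
  by rewrite -setI_eq0 setIUl setU_eq0 !setI_eq0 dAC.
have := max_card (mem ((A :|: B) :|: C)); rewrite card_ord.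
have [_ ] := leq_card_setU (A :|: B) C; rewrite dABC => /eqP ->.
by have := cardsUI A B; rewrite cA cB cC; lia.
Qed.

Section KneserColoring.
Variables (F : finFieldType) (n k r : nat) (iota : 'I_n -> F).
Hypothesis iota_inj : injective iota.

Definition set_poly (A : {set 'I_n}) : {poly F} :=
  \prod_(a in A) ('X - (iota a)%:P).

Lemma set_polyE A :
  set_poly A = \prod_(z <- [seq iota a | a <- enum A]) ('X - z%:P).
Proof. by rewrite big_map big_enum. Qed.

Lemma size_set_poly A : size (set_poly A) = #|A|.+1.
Proof. by rewrite set_polyE size_prod_XsubC size_map -cardE. Qed.

Lemma root_set_poly A x : root (set_poly A) (iota x) = (x \in A).
Proof. by rewrite set_polyE root_prod_XsubC mem_map // mem_enum. Qed.

Lemma set_poly_inj : injective set_poly.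
Proof. by move=> A B eqAB; apply/setP => x; rewrite -!root_set_poly eqAB. Qed.

(** In the difference the leading terms cancel as well as the [r] coefficients below them, so fewer
    coefficients remain than there are common roots. *)
Lemma set_poly_top_coef_inj (A B : {set 'I_n}) :
  #|A| = k -> #|B| = k -> (k - r <= #|A :&: B|)%N ->
  (forall i, (i < r)%N -> (set_poly A)`_(k.-1 - i) = (set_poly B)`_(k.-1 - i)) ->
  A = B.
Proof.
move=> cA cB cAB eq_coef; apply: set_poly_inj; apply/eqP; rewrite -subr_eq0.
have lead (C : {set _}) : #|C| = k -> (set_poly C)`_k = 1.
  move=> cC; have /monicP := monic_prod_XsubC [seq iota a | a <- enum C] predT id.
  by rewrite -set_polyE lead_coefE size_set_poly cC.
apply/eqP/(roots_geq_poly_eq0 (rs := [seq iota a | a <- enum (A :&: B)])).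
- apply/allP => _ /mapP[a + ->]; rewrite mem_enum inE => /andP[aA aB].
  by rewrite rootE hornerD hornerN !(rootP _) ?subr0 ?root_set_poly.
- by rewrite map_inj_uniq ?enum_uniq.
rewrite size_map -cardE; apply: leq_trans cAB.
apply/leq_sizeP => j le_j; rewrite coefB; apply/eqP; rewrite subr_eq0; apply/eqP.
case: (ltngtP j k) => [lt_jk|lt_kj|->]; last by rewrite !lead.
  have -> : j = (k.-1 - (k.-1 - j))%N by lia.
  by apply: eq_coef; lia.
by rewrite !nth_default ?size_set_poly ?cA ?cB.
Qed.

Lemma kneser_injective_colorable :
  (n <= 2 * k + r)%N -> injective_colorable (@kneser n k) (#|F| ^ r).
Proof.
move=> le_n; pose col (A : kneser_vertex n k) : {ffun 'I_r -> F} :=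
  [ffun i : 'I_r => (set_poly (val A))`_(k.-1 - i)].
have card_col : #|{: {ffun 'I_r -> F}}| = (#|F| ^ r)%N by rewrite card_ffun card_ord.
apply/existsP; exists [ffun A => cast_ord card_col (enum_rank (col A))].
apply/forallP => A; apply/forallP => B; apply/implyP => /andP[neAB].
case/existsP => C /andP[dAC dBC]; rewrite !ffunE.
rewrite (inj_eq (@cast_ord_inj _ _ _)) (inj_eq enum_rank_inj).
apply: contra neAB => /eqP/ffunP eq_col; apply/eqP/val_inj.
have [cA cB cC] := And3 (eqP (valP A)) (eqP (valP B)) (eqP (valP C)).
apply: set_poly_top_coef_inj => // [|i lt_ir]; last first.
  by have := eq_col (Ordinal lt_ir); rewrite !ffunE.
exact: (card_setI_common_disjoint cA cB cC).
Qed.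

End KneserColoring.

Lemma injective_chromatic_number_le (T : finType) (e : rel T) m :
  injective_colorable e m -> (injective_chromatic_number e <= m)%N.
Proof. by rewrite /injective_chromatic_number; case: ex_minnP => c _; apply. Qed.

Lemma kneser_injective_chromatic_number_le (k r p e : nat) :
  prime p -> (0 < e)%N -> (2 * k + r <= p ^ e)%N ->
  (injective_chromatic_number (@kneser (2 * k + r) k) <= (p ^ e) ^ r)%N.
Proof.
move=> p_pr e_gt0 le_n; have [F _ cardF] := pPrimePowerField p_pr e_gt0.
rewrite -{}cardF in le_n *.
(* As n <= #|F|, the first n elements in the enumeration of [F] serve as the ground set. *)
pose iota (i : 'I_(2 * k + r)) : F := enum_val (widen_ord le_n i).
have iota_inj : injective iota.
  by move=> i j /enum_val_inj eq_ij; apply: val_inj; have := congr1 val eq_ij.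
apply: injective_chromatic_number_le.
exact: (kneser_injective_colorable iota_inj (leqnn _)).
Qed.

(** With n = 2k + r the base on the right is 9(n + 3)/8, so multiplying by 8 leaves an inequality of
    naturals. *)
Lemma expr_nat_le_bound (R : numFieldType) (k r q : nat) :
  (8 * q <= 9 * (2 * k + r) + 27)%N ->
  q%:R ^+ r <= (9%:R / 4%:R * k%:R + 9%:R * (r%:R + 3%:R) / 8%:R) ^+ r :> R.
Proof.
move=> q_le; apply: lerXn2r; rewrite ?nnegrE ?ler0n //.
  by rewrite !(addr_ge0, mulr_ge0, invr_ge0, ler0n).
have h8 : 0 < 8%:R :> R by rewrite ltr0n.
rewrite -(ler_pM2r h8) mulrDl divfK ?lt0r_neq0 // mulrAC.
have -> : 9%:R / 4%:R * 8%:R = 18%:R :> R.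
  by rewrite mulrAC -natrM (natrM _ 18 4) mulfK // pnatr_eq0.
by rewrite -natrD -!natrM -natrD ler_nat; lia.
Qed.

Theorem theorem2p4 (k r : nat) (hr : (1 <= r)%N) (hrk : (r <= k - 2)%N) :
  (injective_chromatic_number (@kneser (2 * k + r) k))%:R
    <= (9%:R / 4%:R * k%:R + 9%:R * (r%:R + 3%:R) / 8%:R) ^+ r :> rat.
Proof.
(* The hypotheses force k >= 3 and r >= 1, so n reaches the start of the prime chain. *)
have n_ge7 : (7 <= 2 * k + r)%N by lia.
have [p [e [p_pr e_gt0 le_nq q_le]]] := prime_power_between n_ge7.
have chi_le := kneser_injective_chromatic_number_le p_pr e_gt0 le_nq.
apply: (@le_trans _ _ (((p ^ e) ^ r)%N%:R)); first by rewrite ler_nat.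
by rewrite natrX; apply: expr_nat_le_bound.
Qed.
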